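(* Let $d$ be an odd prime, $n\ge1$, let $G=\begin{pmatrix} g_{00} & g_{01} \\ g_{10} & g_{11} \end{pmatrix}$ be any invertible matrix over $\mathbb Z_d$ with $N_G=(\det G)^{-1}$, and let $\sigma$ be a state on $(\mathbb C^d)^{\otimes n}$. Then for every $(a,b)\in\mathbb Z_d^n\times\mathbb Z_d^n$ and every state $\rho$ on $(\mathbb C^d)^{\otimes n}$, $$\Lambda_\sigma[w(a,b)\rho w(a,b)^\dagger]=w(g_{00}a,N_Gg_{11}b)\,\Lambda_\sigma(\rho)\,w(g_{00}a,N_Gg_{11}b)^\dagger.$$
   Context: Weyl operators. $\omega_d=e^{2\pi i/d}$. On one qudit $X|k\rangle=|k+1\rangle$, $Z|k\rangle=\omega_d^k|k\rangle$ (arithmetic mod $d$). For $p,q\in\mathbb Z_d^n$, $Z^p=\bigotimes_i Z^{p_i}$, $X^q=\bigotimes_i X^{q_i}$, and $w(p,q)=\omega_d^{-2^{-1}p\cdot q}Z^pX^q$ on $(\mathbb C^d)^{\otimes n}$, where $2^{-1}$ is the inverse of $2$ in $\mathbb Z_d$. Convolutional channel. $U_G$ is the unitary on $\mathcal H_A\otimes\mathcal H_B$, $\mathcal H_A=\mathcal H_B=(\mathbb C^d)^{\otimes n}$, with $U_G|i,j\rangle=|N_Gg_{11}i-N_Gg_{10}j,\,-N_Gg_{01}i+N_Gg_{00}j\rangle$ for $i,j\in\mathbb Z_d^n$. For a state $\sigma$ on $\mathcal H_B$, $\Lambda_\sigma(\rho)=\operatorname{tr}_B[U_G(\rho\otimes\sigma)U_G^\dagger]$.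 *)

(* Defs.v *)
From HB Require Import structures.
From mathcomp Require Import all_boot all_order all_algebra.
From mathcomp Require Import reals trigo.
From mathcomp Require Import complex mxtens.

Set Implicit Arguments.
Unset Strict Implicit.
Unset Printing Implicit Defensive.

Import Order.TTheory GRing.Theory Num.Theory.

Local Open Scope ring_scope.
Local Open Scope complex_scope.
Local Open Scope sesquilinear_scope.

(* Z_d is rendered as 'Z_d, which is the ring of integers mod d only when
   1 < d; the definitions are meant for d an odd prime.  The Hilbert space with orthonormal
   basis a finite type T is the space of column vectors of size #|T|, through
   enum_rank : T -> 'I_#|T|; the basis of (C^d)^{(x) n} is Z_d^n. *)
Notation qdim d := #|{: 'Z_d}|.
Notation qndim d n := #|{: 'rV['Z_d]_n}|.

Section Quantum.
Variable R : realType.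

Definition ket (T : finType) (x : T) : 'cV[R[i]]_#|T| :=
  delta_mx (enum_rank x) 0.

(* On R[i], 0 <= z says that z is a nonnegative real; hence the first
   condition also forces rho to be Hermitian. *)
Definition is_state (m : nat) (rho : 'M[R[i]]_m) : Prop :=
  (forall v : 'cV[R[i]]_m, 0 <= (v ^t* *m rho *m v) 0 0) /\ \tr rho = 1.

(* The entry of index (i, j), (i', j') of A *t B is A i i' * B j j'. *)
Definition ptraceB (m k : nat) (M : 'M[R[i]]_(m * k)) : 'M[R[i]]_m :=
  \matrix_(i, j) \sum_(l < k) M (mxtens_index (i, l)) (mxtens_index (j, l)).

Section Qudits.
Variable d : nat.

Definition omega : R[i] :=
  let t := 2 * pi / d%:R in cos t +i* sin t.

(* omega ^ c for a residue c, through its representative in {0, ..., d-1}. *)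
Definition omegaZ (c : 'Z_d) : R[i] := omega ^+ (c : nat).

Definition shiftX : 'M[R[i]]_(qdim d) :=
  \sum_(k : 'Z_d) ket (k + 1) *m (ket k) ^t*.

Definition clockZ : 'M[R[i]]_(qdim d) :=
  \sum_(k : 'Z_d) omegaZ k *: (ket k *m (ket k) ^t*).

Variable n : nat.

(* A 0 (x) ... (x) A (n-1), written in the product basis
   |x> = |x_0> (x) ... (x) |x_(n-1)>, x in Z_d^n. *)
Definition tens_ops (A : 'I_n -> 'M[R[i]]_(qdim d)) : 'M[R[i]]_(qndim d n) :=
  \matrix_(r, s) \prod_(i < n)
     let x : 'rV['Z_d]_n := enum_val r in let y : 'rV['Z_d]_n := enum_val s in
     A i (enum_rank (x 0 i)) (enum_rank (y 0 i)).

Definition Zpow (p : 'rV['Z_d]_n) := tens_ops (fun i => clockZ ^+ (p 0 i : nat)).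
Definition Xpow (q : 'rV['Z_d]_n) := tens_ops (fun i => shiftX ^+ (q 0 i : nat)).

Definition dotZ (p q : 'rV['Z_d]_n) : 'Z_d := \sum_(i < n) p 0 i * q 0 i.

Definition weyl (p q : 'rV['Z_d]_n) : 'M[R[i]]_(qndim d n) :=
  omegaZ (- (2^-1 * dotZ p q)) *: (Zpow p *m Xpow q).

Variable G : 'M['Z_d]_2.

Definition NG : 'Z_d := (\det G)^-1.

Definition UG : 'M[R[i]]_(qndim d n * qndim d n) :=
  \sum_(i : 'rV['Z_d]_n) \sum_(j : 'rV['Z_d]_n)
    (ket ((NG * G 1 1) *: i - (NG * G 1 0) *: j)
       *t ket (- ((NG * G 0 1) *: i) + (NG * G 0 0) *: j))
    *m (ket i *t ket j) ^t*.

Definition conv_channel (sigma rho : 'M[R[i]]_(qndim d n)) :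
    'M[R[i]]_(qndim d n) :=
  ptraceB (UG *m (rho *t sigma) *m UG ^t*).

End Qudits.
End Quantum.

(* Main.v *)
(* In the computational basis Weyl operators and U_G are monomial matrices:
   each row has a single nonzero entry, of modulus 1.  The row (x, l) of U_G has
   its entry in the column (g00 x + g10 l, g01 x + g11 l).  Hence the entry
   (x, x') of Lambda_sigma(rho) is the sum over l of
     rho(g00 x + g10 l, g00 x' + g10 l) sigma(g01 x + g11 l, g01 x' + g11 l).
   Conjugating rho by w(a, b) produces phases, whose l-dependent parts cancel
   between x and x', and a shift by b of the arguments of rho, which the
   substitution l -> l + N_G g01 b turns into a shift of x and x' by N_G g11 b. *)
Require Import Defs.
From mathcomp Require Import all_boot all_order all_algebra.
From mathcomp Require Import reals trigo.
From mathcomp Require Import complex mxtens.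
From mathcomp Require Import ring.

Set Implicit Arguments.
Unset Strict Implicit.
Unset Printing Implicit Defensive.

Import Order.TTheory GRing.Theory Num.Theory.

Local Open Scope ring_scope.
Local Open Scope complex_scope.
Local Open Scope sesquilinear_scope.

(** Row [r] of [U] is nonzero only in column [f r], so both sums of the triple product collapse to
    one term. *)
Lemma conj_monomial_mx (C : numClosedFieldType) (m k : nat) (c : 'I_m -> C)
    (f : 'I_m -> 'I_k) (M : 'M[C]_k)
    (U := \matrix_(r, s) (c r *+ (s == f r)) : 'M[C]_(m, k)) :
  U *m M *m U ^t* = \matrix_(r, s) (c r * (c s)^* * M (f r) (f s)).
Proof.
apply/matrixP => r s; rewrite !mxE (bigD1 (f s)) //= big1 => [|j jN]; last first.
  by rewrite !mxE (negPf jN) mulr0n conjC0 mulr0.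
rewrite addr0 !mxE eqxx mulr1n (bigD1 (f r)) //= big1 => [|j jN]; last first.
  by rewrite !mxE (negPf jN) mulr0n mul0r.
by rewrite !mxE eqxx mulr1n addr0 mulrAC.
Qed.

(** One vanishing factor kills the product. This makes a tensor product of monomial matrices
    monomial. *)
Lemma prod_mulrb (A : comPzRingType) (I : finType) (F : I -> A) (b : pred I) :
  \prod_i (F i *+ b i) = (\prod_i F i) *+ [forall i, b i].
Proof.
have [/forallP hb|] := boolP [forall i, b i].
  by rewrite mulr1n; apply: eq_bigr => i _; rewrite hb.
by case/forallPn => i bi; rewrite (bigD1 i) //= (negPf bi) mulr0n mul0r.
Qed.

Section Phases.
Variables (R : realType) (d : nat).
Hypothesis d_gt1 : (1 < d)%N.

Lemma cos_sin_exp (t : R) (m : nat) :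
  (cos t +i* sin t) ^+ m = cos (t *+ m) +i* sin (t *+ m) :> R[i].
Proof.
elim: m => [|m IHm]; first by rewrite expr0 mulr0n cos0 sin0.
rewrite exprS IHm mulrS cosD sinD; apply/eqP; rewrite eq_complex /=.
by rewrite eqxx /= addrC.
Qed.

Lemma omega_exp_dim : omega R d ^+ d = 1.
Proof.
have d_neq0 : d%:R != 0 :> R by rewrite pnatr_eq0 -lt0n ltnW.
(* The summand [0] gives the angle the shape expected by [cosD2pi] and [sinD2pi]. *)
have td : (2 * pi / d%:R) *+ d = 0 + pi *+ 2 :> R.
  by rewrite -[LHS]mulr_natr divfK // mulr_natl add0r.
by rewrite /omega cos_sin_exp td cosD2pi sinD2pi cos0 sin0.
Qed.

Lemma norm_omega : `|omega R d| = 1.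
Proof.
apply/eqP; rewrite -(pexpr_eq1 (n := d)) // ?(ltnW d_gt1) //.
by rewrite -normrX omega_exp_dim normr1.
Qed.

(** Operations in ['Z_d] reduce representatives modulo [(Zp_trunc d).+2], which is [d] since
    [1 < d]; powers of [omega] do not see this reduction. *)
Lemma omega_exp_mod (m : nat) :
  omega R d ^+ (m %% (Zp_trunc d).+2) = omega R d ^+ m.
Proof. by rewrite Zp_cast // expr_mod // omega_exp_dim. Qed.

Lemma omegaZ0 : omegaZ R (0 : 'Z_d) = 1.
Proof. by []. Qed.

Lemma omegaZD (x y : 'Z_d) : omegaZ R (x + y) = omegaZ R x * omegaZ R y.
Proof. by rewrite /omegaZ /= omega_exp_mod exprD. Qed.

Lemma omegaZM (x y : 'Z_d) : omegaZ R (x * y) = omegaZ R x ^+ y.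
Proof. by rewrite /omegaZ /= omega_exp_mod exprM. Qed.

Lemma omegaZ_sum (I : finType) (F : I -> 'Z_d) :
  omegaZ R (\sum_i F i) = \prod_i omegaZ R (F i).
Proof. exact: (big_morph _ omegaZD omegaZ0). Qed.

Lemma omegaZ_conj (x : 'Z_d) : omegaZ R x * (omegaZ R x)^*%R = 1.
Proof. by rewrite -normCK normrX norm_omega !expr1n. Qed.

Lemma ketE (T : finType) (x : T) r s : ket R x r s = (enum_val r == x)%:R.
Proof. by rewrite !mxE ord1 andbT -(can_eq enum_valK) enum_rankK. Qed.

Lemma ket_adjE (T : finType) (x : T) r s :
  ((ket R x) ^t*) r s = (enum_val s == x)%:R.
Proof. by rewrite 2!mxE ketE conjC_nat. Qed.

Lemma clockZ_exp (m : nat) (x y : 'Z_d) :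
  (clockZ R d ^+ m) (enum_rank x) (enum_rank y) = omegaZ R x ^+ m *+ (x == y).
Proof.
have clockE : clockZ R d = diag_mx (\row_k omegaZ R (enum_val k : 'Z_d)).
  apply/matrixP => r s; rewrite summxE (bigD1 (enum_val r)) //= big1; last first.
    move=> k kN; rewrite !mxE big_ord1 ketE eq_sym (negPf kN).
    by rewrite mul0r mulr0.
  rewrite !mxE big_ord1 ketE eqxx mul1r ket_adjE addr0 mulr_natr.
  by rewrite (inj_eq enum_val_inj) eq_sym.
elim: m x y => [|m IHm] x y.
  by rewrite !expr0 !mxE (inj_eq enum_rank_inj).
rewrite !exprS -[_ * _]/(_ *m _) {1}clockE mul_diag_mx !mxE enum_rankK IHm.
by rewrite mulrnAr.
Qed.

Lemma shiftX_exp (m : nat) (x y : 'Z_d) :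
  (shiftX R d ^+ m) (enum_rank x) (enum_rank y) = (x == y + m%:R)%:R.
Proof.
have shiftE r s : shiftX R d r s = (s == enum_rank (enum_val r - 1))%:R.
  rewrite summxE (bigD1 (enum_val s)) //= big1; last first.
    move=> k kN; rewrite mxE big_ord1 ket_adjE.
    by rewrite eq_sym (negPf kN) mulr0.
  rewrite mxE big_ord1 ketE ket_adjE eqxx mulr1 addr0.
  rewrite -[s in RHS]enum_valK (inj_eq enum_rank_inj).
  by rewrite -subr_eq eq_sym.
elim: m x y => [|m IHm] x y.
  by rewrite !expr0 mxE (inj_eq enum_rank_inj) addr0.
rewrite exprS -[_ * _]/(_ *m _) !mxE (bigD1 (enum_rank (x - 1))) //= big1.
  by rewrite addr0 shiftE enum_rankK eqxx mul1r IHm -natr1 addrA subr_eq.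
by move=> k kN; rewrite shiftE enum_rankK (negPf kN) mul0r.
Qed.

Variable n : nat.
Implicit Types p q x y : 'rV['Z_d]_n.

Lemma row_eqb x y : (x == y) = [forall i, x 0 i == y 0 i].
Proof.
apply/eqP/forallP => [-> // | xy].
by apply/rowP => i; apply/eqP.
Qed.

(* Without the cast, enum_rank is elaborated at a finType instance inherited
   from the ring structure, which does not match the one in qndim. *)
Lemma weylE p q : weyl R p q =
  \matrix_(r, s) ((omegaZ R (- (2^-1 * dotZ p q))
                   * omegaZ R (dotZ p (enum_val r)))
                  *+ (s == enum_rank (enum_val r - q : 'rV['Z_d]_n))).
Proof.
have ZE : Zpow R p = diag_mx (\row_k omegaZ R (dotZ p (enum_val k))).
  apply/matrixP => r s; rewrite !mxE.
  under eq_bigr => i _ do rewrite /= clockZ_exp -omegaZM mulrC.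
  by rewrite prod_mulrb -row_eqb (inj_eq enum_val_inj) -omegaZ_sum.
rewrite /weyl ZE; apply/matrixP => r s; rewrite mul_diag_mx !mxE.
(* Reading the truth value as [1 *+ _] lets [prod_mulrb] apply. *)
under eq_bigr => i _ do rewrite /= shiftX_exp natr_Zp -[_%:R]/(1 *+ _).
rewrite prod_mulrb big1 // mulr_natr mulrnAr; congr (_ *+ nat_of_bool _).
rewrite -(inj_eq enum_val_inj) enum_rankK [RHS]eq_sym subr_eq row_eqb.
by apply: eq_forallb => i; rewrite !mxE.
Qed.

(** The scalar prefactor of [weyl] has modulus 1 and cancels against its conjugate. *)
Lemma weyl_conj p q (M : 'M[R[i]]_(qndim d n)) x y :
  (weyl R p q *m M *m (weyl R p q) ^t*) (enum_rank x) (enum_rank y) =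
  omegaZ R (dotZ p x) * (omegaZ R (dotZ p y))^*%R
    * M (enum_rank (x - q : 'rV['Z_d]_n))
        (enum_rank (y - q : 'rV['Z_d]_n)).
Proof.
rewrite weylE conj_monomial_mx mxE !enum_rankK; congr (_ * _).
by rewrite rmorphM mulrACA omegaZ_conj mul1r.
Qed.

Lemma dotZDr p x y : dotZ p (x + y) = dotZ p x + dotZ p y.
Proof.
by rewrite -big_split; apply: eq_bigr => i _; rewrite mxE mulrDr.
Qed.

Lemma dotZZr p (c : 'Z_d) x : dotZ p (c *: x) = dotZ (c *: p) x.
Proof. by apply: eq_bigr => i _; rewrite !mxE mulrCA mulrA. Qed.

End Phases.

Lemma linear_system2 (A : comPzRingType) (n : nat) (a b c e N : A)
    (detN : N * (a * e - b * c) = 1) (x y i j : 'rV[A]_n) :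
  ((x == (N * e) *: i - (N * c) *: j)
     && (y == - ((N * b) *: i) + (N * a) *: j)) =
  ((i == a *: x + c *: y) && (j == b *: x + e *: y)).
Proof.
apply/andP/andP => -[/eqP-> /eqP->]; split; apply/eqP/rowP => k; rewrite !mxE.
(* Once the left side is multiplied by [N * (a * e - b * c)], each equation is a polynomial
   identity. *)
- by rewrite -[LHS]mul1r -detN; ring.
- by rewrite -[LHS]mul1r -detN; ring.
- by rewrite -[LHS]mul1r -detN; ring.
- by rewrite -[LHS]mul1r -detN; ring.
Qed.

Section Channel.
Variables (R : realType) (d n : nat) (G : 'M['Z_d]_2).
Hypothesis G_unit : G \in unitmx.
Implicit Types x y i j : 'rV['Z_d]_n.

Lemma NG_det : NG G * (G 0 0 * G 1 1 - G 0 1 * G 1 0) = 1.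
Proof.
have <- : \det G = G 0 0 * G 1 1 - G 0 1 * G 1 0.
  rewrite (expand_det_row _ 0) !big_ord_recl big_ord0 addr0 /cofactor !det_mx11.
  rewrite !mxE /= expr0 expr1 mul1r mulN1r mulrN.
  (* The minors carry indices built with [lift], equal to the literal ones by value. *)
  by congr (_ * G _ _ - G _ _ * G _ _); apply: val_inj.
by rewrite mulVr // -unitmxE.
Qed.

(** [UG] is defined by the image of each column; inverting the linear system locates the nonzero
    entry of each row, as [conj_monomial_mx] requires. *)
Lemma UGE x y i j :
  UG R n G (mxtens_index (enum_rank x, enum_rank y))
           (mxtens_index (enum_rank i, enum_rank j)) =
  ((i == G 0 0 *: x + G 1 0 *: y) && (j == G 0 1 *: x + G 1 1 *: y))%:R.
Proof.
rewrite -(linear_system2 NG_det).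
have E i' j' u v :
    ((ket R u *t ket R v) *m (ket R i' *t ket R j') ^t*)
      (mxtens_index (enum_rank x, enum_rank y))
      (mxtens_index (enum_rank i, enum_rank j)) =
    ((x == u) && (y == v))%:R * ((i == i') && (j == j'))%:R.
  rewrite trmx_tens map_mxT tensmx_mul tensmxE !mxE !big_ord1.
  by rewrite !ketE !ket_adjE !enum_rankK -!mulnb !natrM mulrACA.
rewrite summxE (bigD1 i) //= [X in _ + X]big1 ?addr0; last first.
  move=> i' iN; rewrite summxE big1 // => j' _.
  by rewrite E [i == i']eq_sym (negPf iN) mulr0.
rewrite summxE (bigD1 j) //= [X in _ + X]big1 ?addr0; last first.
  by move=> j' jN; rewrite E [j == j']eq_sym (negPf jN) andbF mulr0.
by rewrite E !eqxx mulr1.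
Qed.

Lemma conv_channelE (sigma rho : 'M[R[i]]_(qndim d n)) x y :
  conv_channel G sigma rho (enum_rank x) (enum_rank y) =
  \sum_(l : 'rV['Z_d]_n)
     rho (enum_rank (G 0 0 *: x + G 1 0 *: l : 'rV['Z_d]_n))
         (enum_rank (G 0 0 *: y + G 1 0 *: l : 'rV['Z_d]_n))
     * sigma (enum_rank (G 0 1 *: x + G 1 1 *: l : 'rV['Z_d]_n))
             (enum_rank (G 0 1 *: y + G 1 1 *: l : 'rV['Z_d]_n)).
Proof.
(* [f r] is the column of the only nonzero entry of [UG] in row [r]. *)
pose f (r : 'I_(qndim d n * qndim d n)) : 'I_(qndim d n * qndim d n) :=
  let u := enum_val (mxtens_unindex r).1 : 'rV['Z_d]_n in
  let l := enum_val (mxtens_unindex r).2 : 'rV['Z_d]_n in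
  mxtens_index (enum_rank (G 0 0 *: u + G 1 0 *: l : 'rV['Z_d]_n),
                enum_rank (G 0 1 *: u + G 1 1 *: l : 'rV['Z_d]_n)).
have UGf : UG R n G = \matrix_(r, s) (1 *+ (s == f r)).
  apply/matrixP => r s; rewrite mxE.
  case: (mxtens_indexP r) => r1 r2; case: (mxtens_indexP s) => s1 s2.
  rewrite -[r1]enum_valK -[r2]enum_valK -[s1]enum_valK -[s2]enum_valK UGE.
  rewrite /f mxtens_indexK /= !enum_rankK.
  by rewrite (can_eq (@mxtens_indexK _ _)) xpair_eqE !(inj_eq enum_rank_inj).
rewrite /conv_channel UGf conj_monomial_mx mxE.
rewrite (reindex _ (onW_bij _ (@enum_rank_bij _))).
apply: eq_bigr => l _.
by rewrite mxE conjC1 !mul1r /f !mxtens_indexK /= !enum_rankK tensmxE.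
Qed.

End Channel.

Theorem theorem1 (R : realType) (d n : nat) (hd : prime d) (hodd : odd d)
    (hn : (0 < n)%N) (G : 'M['Z_d]_2) (hG : G \in unitmx)
    (sigma : 'M[R[i]]_(qndim d n)) (hsigma : is_state sigma)
    (a b : 'rV['Z_d]_n)
    (rho : 'M[R[i]]_(qndim d n)) (hrho : is_state rho) :
  conv_channel G sigma (weyl R a b *m rho *m (weyl R a b) ^t*) =
  weyl R (G 0 0 *: a) ((NG G * G 1 1) *: b) *m conv_channel G sigma rho
    *m (weyl R (G 0 0 *: a) ((NG G * G 1 1) *: b)) ^t*.
Proof.
have d_gt1 := prime_gt1 hd.
apply/matrixP => r s; rewrite -[r]enum_valK -[s]enum_valK.
move: (enum_val r) (enum_val s) => x y {r s}.
rewrite weyl_conj // !conv_channelE // mulr_sumr.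
(* This value makes the two shifts cancel in the arguments of [sigma], while in those of [rho] they
   add up to [- (NG G * \det G) *: b], that is [- b]. *)
set c := NG G * G 0 1.
rewrite [RHS](reindex_inj (addIr (c *: b))) /=; apply: eq_bigr => l _.
have shift_i z : G 0 0 *: (z - (NG G * G 1 1) *: b) + G 1 0 *: (l + c *: b)
    = G 0 0 *: z + G 1 0 *: l - b.
  apply/rowP => k; rewrite !mxE -[b 0 k in RHS]mul1r -(NG_det hG) /c.
  by ring.
have shift_j z : G 0 1 *: (z - (NG G * G 1 1) *: b) + G 1 1 *: (l + c *: b)
    = G 0 1 *: z + G 1 1 *: l.
  by apply/rowP => k; rewrite !mxE /c; ring.
rewrite !shift_i !shift_j weyl_conj // mulrA; congr (_ * _ * _).
(* Moving [G 0 0] from [x] and [y] onto [a] yields the first Weyl parameter of the right side; the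
   phase in [l] meets its conjugate. *)
rewrite !dotZDr !dotZZr !omegaZD // rmorphM mulrACA.
by rewrite omegaZ_conj // mulr1.
Qed.
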